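(* Let $\boldsymbol{x}=(x_1,\dots,x_n)\in\mathcal{X}^n$ and define $C\in\mathbb{R}^{n\times n}$ by $C_{i,j}:=\frac{k(x_i,x_j)}{\sqrt{k(x_i,x_i)k(x_j,x_j)}}$. Denote by $C_{S,S}$ the restriction of $C$ onto the indices contained in $S$, and let $\lambda_{\mathrm{min}}(C,k):=\min_{|S|\le k}\lambda_{\mathrm{min}}(C_{S,S})$ denote the minimal $k$-sparse eigenvalue of $C$. Then the set function $\eta$ on subsets of $\{1,\dots,n\}$, $\eta(S):=\operatorname{tr}(G^{\boldsymbol{x}_S})=\sum_{j=1}^d\|P_{\mathcal{V}_{\boldsymbol{x}_S}}b_j\|_{\mathcal{V}}^2$, is monotone and approximately submodular with $$\gamma_{U,k}(\eta)\ge\lambda_{\mathrm{min}}(C,|U|+k)\ge\lambda_{\mathrm{min}}(C)$$ for all $U\subseteq\{1,\dots,n\}$ and $k\ge1$.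
   Context: $\mathcal{V}$ is a real reproducing kernel Hilbert space of functions on $\mathcal{X}$ with inner product $(\cdot,\cdot)_{\mathcal{V}}$, norm $\|\cdot\|_{\mathcal{V}}$ and reproducing kernel $k(\cdot,\cdot)$ with $k(x_i,x_i)>0$; $\mathcal{V}_d\subseteq\mathcal{V}$ is a fixed $d$-dimensional subspace with $\mathcal{V}$-orthonormal basis $b_1,\dots,b_d$. For $S\subseteq\{1,\dots,n\}$, $\boldsymbol{x}_S$ is the sub-vector of $\boldsymbol{x}$ with indices in $S$, $P_{\mathcal{V}_{\boldsymbol{x}_S}}$ is the $\mathcal{V}$-orthogonal projection onto $\mathcal{V}_{\boldsymbol{x}_S}:=\operatorname{span}\{k(x_i,\cdot):i\in S\}$, and $G^{\boldsymbol{x}_S}_{ij}:=(P_{\mathcal{V}_{\boldsymbol{x}_S}}b_i,b_j)_{\mathcal{V}}$. A set function $f:2^{\mathcal{D}}\to[0,\infty)$ is monotone if $f(S)\le f(T)$ whenever $S\subseteq T$. For a non-negative monotone $f$, its submodularity ratio with respect to $U\subseteq\mathcal{D}$ and $k\ge1$ is $$\gamma_{U,k}(f):=\min_{L\subseteq U,\;S:\,|S|\le k,\;L\cap S=\emptyset}\frac{\sum_{s\in S}[f(L\cup\{s\})-f(L)]}{f(L\cup S)-f(L)},$$ with the convention $0/0=1$. ''Approximately submodular'' refers to the stated lower bound on $\gamma_{U,k}$. $\lambda_{\mathrm{min}}$ of a symmetric matrix is its smallest eigenvalue, and in $\lambda_{\mathrm{min}}(C,k)$ the minimum is over nonempty $S\subseteq\{1,\dots,n\}$.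 *)

(* Defs.v *)
From HB Require Import structures.
From mathcomp Require Import all_boot all_order all_algebra.
From mathcomp Require Import all_classical all_reals all_analysis.

Set Implicit Arguments.
Unset Strict Implicit.
Unset Printing Implicit Defensive.

Import Order.TTheory GRing.Theory Num.Theory.
Import numFieldNormedType.Exports.

Local Open Scope classical_set_scope.
Local Open Scope ring_scope.

(* A real reproducing kernel Hilbert space of functions on X.  The vectors form
   a complete normed module whose norm comes from the inner product [rkhs_dot];
   a vector f is identified with the function [rkhs_fun f] on X through an
   injective linear map.  [kernel_at x] is the element k(x, .) of the space. *)
Record rkhs (R : realType) (X : Type) := Rkhs {
  rkhs_space :> completeNormedModType R;
  rkhs_fun : {linear rkhs_space -> (X -> R)};
  rkhs_fun_inj : injective rkhs_fun;
  rkhs_dot : {dot rkhs_space for @idfun R};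
  rkhs_normE : forall f : rkhs_space, `|f| = Num.sqrt (rkhs_dot f f);
  kernel_at : X -> rkhs_space;
  kernel_reproducing : forall (f : rkhs_space) (x : X),
    rkhs_fun f x = rkhs_dot f (kernel_at x)
}.

Arguments rkhs_fun {R X} V : rename.
Arguments rkhs_fun_inj {R X} V : rename.
Arguments rkhs_dot {R X} V : rename.
Arguments rkhs_normE {R X} V f : rename.
Arguments kernel_at {R X} V x : rename.
Arguments kernel_reproducing {R X} V f x : rename.

Definition rkhs_kernel (R : realType) (X : Type) (V : rkhs R X) (x y : X) : R :=
  rkhs_fun V (kernel_at V x) y.

Definition span_on (R : realType) (E : lmodType R) (n : nat) (u : 'I_n -> E)
    (S : {set 'I_n}) : set E :=
  [set v | exists c : 'I_n -> R, v = \sum_(i in S) c i *: u i].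

Definition orthonormal_basis (R : realType) (X : Type) (V : rkhs R X) (d : nat)
    (W : set V) (b : 'I_d -> V) : Prop :=
  (forall i j, rkhs_dot V (b i) (b j) = (i == j)%:R) /\ W = span_on b [set: 'I_d]%SET.

(* The unique p in W such that v - p is orthogonal to W; it exists whenever W is
   a closed subspace (in particular when W is finite-dimensional), and the
   value is 0 if there is no such p. *)
Definition orth_proj (R : realType) (X : Type) (V : rkhs R X) (W : set V)
    (v : V) : V :=
  xget 0 [set p | W p /\ forall w, W w -> rkhs_dot V (v - p) w = 0].

(* The least element of A; the value is 0 if A has none. *)
Definition minimum (R : realType) (A : set R) : R :=
  xget 0 [set m | A m /\ lbound A m].

Definition lambda_min (R : realType) (n : nat) (A : 'M[R]_n) : R :=
  minimum [set a | eigenvalue A a].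

(* The principal submatrix A_{S,S}, indices taken in the order of enum S. *)
Definition principal_submx (R : realType) (n : nat) (A : 'M[R]_n)
    (S : {set 'I_n}) : 'M[R]_#|S| :=
  mxsub enum_val enum_val A.

Definition lambda_min_sparse (R : realType) (n : nat) (A : 'M[R]_n)
    (k : nat) : R :=
  minimum [set lambda_min (principal_submx A S)
          | S in [set S : {set 'I_n} | S != finset.set0 /\ (#|S| <= k)%N]].

(* Set functions take values in [0, +oo[, hence the first conjunct. *)
Definition monotone_setfun (R : realType) (T : finType) (f : {set T} -> R) :
    Prop :=
  (forall S, 0 <= f S) /\ (forall S S' : {set T}, S \subset S' -> f S <= f S').

(* Division with the convention 0 / 0 = 1. *)
Definition ratio01 (R : realType) (a b : R) : R :=
  if (a == 0) && (b == 0) then 1 else a / b.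

(* The pair p is (L, S), with S ranging over all subsets of T. *)
Definition submodularity_ratio (R : realType) (T : finType)
    (f : {set T} -> R) (U : {set T}) (k : nat) : R :=
  minimum [set ratio01 (\sum_(s in p.2) (f (s |: p.1)%SET - f p.1))
                       (f (p.1 :|: p.2)%SET - f p.1)
          | p in [set p : {set T} * {set T} |
                   [/\ p.1 \subset U, (#|p.2| <= k)%N
                     & (p.1 :&: p.2)%SET = finset.set0]]].

Section Design.
Variables (R : realType) (X : Type) (V : rkhs R X) (n d : nat).
Variables (x : 'I_n -> X) (b : 'I_d -> V).

(* The projection onto span {k(x_i, .) : i in S}. *)
Definition design_proj (S : {set 'I_n}) : V -> V :=
  orth_proj (span_on (fun i => kernel_at V (x i)) S).

Definition design_gram (S : {set 'I_n}) : 'M[R]_d :=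
  \matrix_(i < d, j < d) rkhs_dot V (design_proj S (b i)) (b j).

Definition design_eta (S : {set 'I_n}) : R := \tr (design_gram S).

Definition correlation_mx : 'M[R]_n :=
  \matrix_(i < n, j < n)
    (rkhs_kernel V (x i) (x j) /
     Num.sqrt (rkhs_kernel V (x i) (x i) * rkhs_kernel V (x j) (x j))).

End Design.

(* Main.v *)
Require Import Defs.
From HB Require Import structures.
From mathcomp Require Import all_boot all_order all_algebra.
From mathcomp Require Import all_classical all_reals all_analysis.
From mathcomp Require Import ring lra.

Import Order.TTheory GRing.Theory Num.Theory.
Import numFieldNormedType.Exports.

Local Open Scope classical_set_scope.
Local Open Scope ring_scope.

Set Implicit Arguments.
Unset Strict Implicit.

(** For a vector v write E_S(v) for the squared norm of its projection onto
the span of the kernels indexed by S, so that eta(S) is the sum of the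
E_S(b_j).  The subspaces grow with S, hence by Pythagoras

  E_T(v) - E_S(v) = |P_T v - P_S v|^2  when S is contained in T,

which gives monotonicity ([energy_gain]).  For the submodularity ratio, it
suffices to treat a single v.  Let e_i be the normalised kernels: they span the
same subspaces, and C is their Gram matrix.  Put T = L u S and
r = P_T v - P_L v.
- The gain of adding one s to L is at least (r, e_s)^2: the vector
  P_(L u {s}) v - P_L v has the same inner product with e_s as r, and e_s has
  norm one, so this is the Cauchy-Schwarz inequality.
- The vector r is orthogonal to every e_i with i in L, so the sum of
  (r, e_s)^2 over s in S is the sum of (r, e_i)^2 over all i in T.
- As r lies in the span of the e_i with i in T, that sum is at least
  lambda |r|^2 for every lambda with lambda |c|^2 <= |sum_i c_i e_i|^2 for all
  coefficients c on T ([frame_lower_bound]).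
Since |r|^2 is the gain of adding all of S at once, the ratio is at least
lambda ([energy_submodular]), and the smallest eigenvalue of the principal
submatrix of C on T is such a lambda; it is at least lambda_min(C, |U| + k)
because T has at most |U| + k elements.

The remaining input is the variational description of the smallest eigenvalue
of a real symmetric matrix: it exists, it is attained by the quadratic form on
the unit sphere, and it bounds that form below ([lambda_minP]).  The form has
a minimum on the compact unit sphere, and a minimiser is an eigenvector because
an isotropic vector of a positive semidefinite form lies in its kernel.
Extending vectors by zero then compares a matrix with its principal
submatrices, which gives lambda_min(C) <= lambda_min(C, k). *)

(** * Inner products *)

Section Dot.
Context {R : realType} {E : lmodType R} (dot : {dot E for @idfun R}).

Lemma dotC u v : dot u v = dot v u.
Proof. by rewrite hermC expr0 mul1r. Qed.

Lemma dot_gt0 u : u != 0 -> 0 < dot u u.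
Proof. exact: neq0_dnorm_gt0. Qed.

Lemma dotBl u v w : dot (u - v) w = dot u w - dot v w.
Proof. exact: linearBl. Qed.

Lemma dotBr u v w : dot u (v - w) = dot u v - dot u w.
Proof. exact: linearBr. Qed.

Lemma dotDr u v w : dot u (v + w) = dot u v + dot u w.
Proof. exact: linearDr. Qed.

Lemma dot0l v : dot 0 v = 0.
Proof. exact: linear0l. Qed.

Lemma dot0r v : dot v 0 = 0.
Proof. exact: linear0r. Qed.

Lemma dotZl a u v : dot (a *: u) v = a * dot u v.
Proof. exact: linearZl_LR. Qed.

Lemma dotZr a u v : dot u (a *: v) = a * dot u v.
Proof. by rewrite dotC dotZl dotC. Qed.

Lemma dot_suml (I : finType) (P : pred I) (F : I -> E) v :
  dot (\sum_(i | P i) F i) v = \sum_(i | P i) dot (F i) v.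
Proof. exact: linear_sumlz. Qed.

Lemma dot_ge0 u : 0 <= dot u u.
Proof.
have [->|u0] := eqVneq u 0; first by rewrite dot0l.
exact/ltW/dot_gt0.
Qed.

(** The discriminant argument, on the vector (v, v) u - (u, v) v so as to avoid
division. *)
Lemma dot_cauchy_schwarz u v : dot u v ^+ 2 <= dot u u * dot v v.
Proof.
have [->|v0] := eqVneq v 0; first by rewrite !dot0r expr0n mulr0.
have vv := dot_gt0 v0.
have := dot_ge0 (dot v v *: u - dot u v *: v).
rewrite !dotBl !dotBr !dotZl !dotZr (dotC v u) => h.
rewrite -subr_ge0 -(pmulr_rge0 _ vv); apply: le_trans h _.
by rewrite le_eqVlt; apply/orP; left; apply/eqP; ring.
Qed.

End Dot.

(** * Orthogonal projection onto the span of finitely many vectors *)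

Section Span.
Context {R : realType} {E : lmodType R} {n : nat} (u : 'I_n -> E).
Implicit Types S T : {set 'I_n}.

Lemma span_on_lin S a v w :
  span_on u S v -> span_on u S w -> span_on u S (a *: v + w).
Proof.
move=> [c ->] [c' ->]; exists (fun i => a * c i + c' i).
rewrite scaler_sumr -big_split; apply: eq_bigr => i _.
by rewrite scalerA scalerDl.
Qed.

Lemma span_on_sub S v w :
  span_on u S v -> span_on u S w -> span_on u S (v - w).
Proof. by move=> Sv Sw; rewrite addrC -scaleN1r; apply: span_on_lin. Qed.

Lemma span_on_mono S T : S \subset T -> span_on u S `<=` span_on u T.
Proof.
move=> ST v [c ->]; exists (fun i => if i \in S then c i else 0).
rewrite [RHS](big_setID S) /= (finset.setIidPr ST) [X in _ = _ + X]big1 ?addr0.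
  by apply: eq_bigr => i ->.
by move=> i; rewrite inE => /andP[/negbTE -> _]; rewrite scale0r.
Qed.

Lemma span_on_gen S i : i \in S -> span_on u S (u i).
Proof.
move=> iS; exists (fun j => (j == i)%:R).
rewrite (bigD1 i) //= eqxx scale1r big1 ?addr0 // => j /andP[_ /negbTE ->].
by rewrite scale0r.
Qed.

Lemma span_on_scale (a : 'I_n -> R) S : (forall i, a i != 0) ->
  span_on (fun i => a i *: u i) S = span_on u S.
Proof.
move=> a0; rewrite predeqE => v; split => -[c ->].
  by exists (fun i => c i * a i); apply: eq_bigr => i _; rewrite scalerA.
exists (fun i => c i / a i); apply: eq_bigr => i _.
by rewrite scalerA divfK.
Qed.

Context (dot : {dot E for @idfun R}).

Lemma span_on_orth S v : (forall i, i \in S -> dot v (u i) = 0) ->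
  forall w, span_on u S w -> dot v w = 0.
Proof.
move=> vS _ [c ->]; rewrite dotC dot_suml big1 // => i iS.
by rewrite dotZl dotC vS ?mulr0.
Qed.

(** One Gram-Schmidt step: when u_i joins a set onto whose span vectors project,
the projection gains the component along the residual g of u_i.  If g = 0 the
span has not grown, and the coefficient is then multiplied by g = 0, so the
same formula covers linearly dependent families. *)
Lemma span_on_proj_exists S v :
  exists p, span_on u S p /\ forall w, span_on u S w -> dot (v - p) w = 0.
Proof.
elim: {S}#|S| {-2}S (erefl #|S|) v => [|m IH] S Sm v.
  exists 0; split; first exists (fun=> 0).
    by rewrite big1 // => i; rewrite scale0r.
  by apply: span_on_orth => i; rewrite (cards0_eq Sm) inE.
have /card_gt0P[i iS] : (0 < #|S|)%N by rewrite Sm.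
have [|q [Sq qP]] := IH (S :\ i) _ (u i).
  by move: Sm; rewrite (cardsD1 i) iS => -[].
have [|p [Sp pP]] := IH (S :\ i) _ v.
  by move: Sm; rewrite (cardsD1 i) iS => -[].
have sub : span_on u (S :\ i) `<=` span_on u S.
  by apply/span_on_mono/subD1set.
have [g [ui Sg gP]] : exists g, [/\ u i = g + q, span_on u S g &
    forall w, span_on u (S :\ i) w -> dot g w = 0].
  exists (u i - q); split => //; first by rewrite subrK.
  by apply: span_on_sub; [apply: span_on_gen|apply: sub].
exists ((dot v g / dot g g) *: g + p); split.
  by apply: span_on_lin => //; apply: sub.
apply: span_on_orth => j jS.
rewrite opprD addrCA addrC dotBl dotZl.
have [->|ji] := eqVneq j i; last first.
  have Sj : span_on u (S :\ i) (u j) by apply: span_on_gen; rewrite !inE ji.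
  by rewrite pP // (gP (u j)) // mulr0 subrr.
rewrite ui !dotDr (pP q) // (gP q) // !addr0 dotBl (dotC _ p) (gP p) // subr0.
have [->|g0] := eqVneq g 0; first by rewrite !dot0r mulr0 subrr.
by rewrite divfK ?subrr // gt_eqF // dot_gt0.
Qed.

End Span.

(** * Energy of projections and its submodularity *)

Section Frame.
Context {R : realType} {E : lmodType R} (dot : {dot E for @idfun R}).
Context {n : nat} (u : 'I_n -> E).

(** A Riesz lower bound for a finite family is a lower frame bound on its span.
With r = sum_i c_i u_i and a_i = (r, u_i), one has (r, r) = sum_i c_i a_i;
expanding sum_i (a_i - lam c_i)^2 >= 0 and bounding lam |c|^2 by (r, r) leaves
lam (r, r) <= |a|^2.  The last bound multiplies by lam, hence the separate
trivial case lam < 0. *)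
Lemma frame_lower_bound (T : {set 'I_n}) (lam : R) r :
    (forall c : 'I_n -> R, let s := \sum_(i in T) c i *: u i in
       lam * \sum_(i in T) c i ^+ 2 <= dot s s) ->
    span_on u T r ->
  lam * dot r r <= \sum_(i in T) dot r (u i) ^+ 2.
Proof.
move=> low Tr; have [lam0|lam0] := leP 0 lam; last first.
  apply: (@le_trans _ _ 0); first by rewrite nmulr_rle0 ?dot_ge0.
  by apply: sumr_ge0 => i _; apply: sqr_ge0.
have [c rE] := Tr; have := low c; rewrite /= -rE => lowc.
have rr : dot r r = \sum_(i in T) c i * dot r (u i).
  rewrite {2}rE dotC dot_suml; apply: eq_bigr => i _.
  by rewrite dotZl dotC.
have : 0 <= \sum_(i in T) (dot r (u i) - lam * c i) ^+ 2.
  by apply: sumr_ge0 => i _; apply: sqr_ge0.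
have -> : \sum_(i in T) (dot r (u i) - lam * c i) ^+ 2 =
    \sum_(i in T) dot r (u i) ^+ 2 - (lam * dot r r) *+ 2
    + lam * (lam * \sum_(i in T) c i ^+ 2).
  rewrite rr !mulr_sumr -sumrMnl -sumrB -big_split /=.
  by apply: eq_bigr => i _; ring.
have := ler_wpM2l lam0 lowc; lra.
Qed.

End Frame.

Section Projection.
Context {R : realType} {X : Type} {V : rkhs R X} {n : nat} (u : 'I_n -> V).
Implicit Types S T L : {set 'I_n}.

Let dot := rkhs_dot V.
Let proj S := orth_proj (span_on u S).

Lemma orth_projP S v :
  span_on u S (proj S v) /\ forall w, span_on u S w -> dot (v - proj S v) w = 0.
Proof.
exact: (xgetPex (0 : V) (span_on_proj_exists u dot S v)).
Qed.

Lemma orth_proj_span S v : span_on u S (proj S v).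
Proof. by have [] := orth_projP S v. Qed.

Lemma dot_orth_projl S v w : span_on u S w -> dot (proj S v) w = dot v w.
Proof.
move=> Sw; have [_ /(_ _ Sw)] := orth_projP S v.
by rewrite dotBl => /subr0_eq.
Qed.

Definition energy S v : R := dot (proj S v) (proj S v).

(** Pythagoras for nested subspaces. *)
Lemma energy_gain S T v : S \subset T ->
  energy T v - energy S v = dot (proj T v - proj S v) (proj T v - proj S v).
Proof.
move=> ST.
have TS : dot (proj T v) (proj S v) = energy S v.
  rewrite dot_orth_projl; last exact/(span_on_mono ST)/orth_proj_span.
  by rewrite -(dot_orth_projl v (orth_proj_span S v)).
rewrite dotBl !dotBr (dotC dot (proj S v)) TS /energy; ring.
Qed.

Lemma energy_le S T v : S \subset T -> energy S v <= energy T v.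
Proof. by move=> ST; rewrite -subr_ge0 energy_gain // dot_ge0. Qed.

(** Once i belongs to T, the part of v that is left over after projecting onto
the span for T is orthogonal to u_i.  So the right-hand side, which does not
depend on T, links the gain of one index with the gain of a whole set. *)
Lemma residual_dot S T v i : i \in T ->
  dot (proj T v - proj S v) (u i) = dot (v - proj S v) (u i).
Proof.
by move=> iT; rewrite !dotBl (dot_orth_projl v (span_on_gen u iT)).
Qed.

(** With r the increment from L to L u S, each single gain dominates (r, u_s)^2
by Cauchy-Schwarz, and these squares add up to at least lam (r, r) by
[frame_lower_bound], because the indices in L contribute nothing. *)
Lemma energy_submodular L S v (lam : R) :
    (forall i, dot (u i) (u i) = 1) ->
    (forall c : 'I_n -> R, let s := \sum_(i in L :|: S) c i *: u i in
       lam * \sum_(i in L :|: S) c i ^+ 2 <= dot s s) ->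
    (L :&: S)%SET = finset.set0 ->
  lam * (energy (L :|: S) v - energy L v) <=
    \sum_(s in S) (energy (s |: L) v - energy L v).
Proof.
move=> u1 low LS; have LT := finset.subsetUl L S.
rewrite energy_gain //; set r := proj _ v - _.
have Tr : span_on u (L :|: S) r.
  by apply: span_on_sub; [|apply: (span_on_mono LT)]; apply: orth_proj_span.
apply: le_trans (frame_lower_bound low Tr) _.
rewrite (big_setID L) /= big1 ?add0r; last first.
  move=> i; rewrite inE => /andP[iT iL].
  rewrite residual_dot //; have [_ ->] := orth_projP L v; rewrite ?expr0n //.
  exact: span_on_gen.
have -> : ((L :|: S) :\: L = S)%SET.
  rewrite finset.setDUl finset.setDv finset.set0U.
  by apply/finset.setDidPl; rewrite -setI_eq0 finset.setIC LS.
apply: ler_sum => s sS.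
have sT : L \subset s |: L by apply: finset.subsetUr.
have sL : s \in s |: L by rewrite !inE eqxx.
rewrite energy_gain // /r residual_dot //; last by rewrite inE sS orbT.
rewrite -(residual_dot L v sL).
by apply: le_trans (dot_cauchy_schwarz _ _ _) _; rewrite u1 mulr1.
Qed.

End Projection.

(** * Smallest eigenvalues as minima of quadratic forms *)

Section Minimum.
Context {R : realType}.

Lemma minimum_eq (A : set R) m : A m -> lbound A m -> minimum A = m.
Proof.
move=> Am lm; rewrite /minimum.
have [Ax lx] := xgetPex (0 : R) (ex_intro _ m (conj Am lm) :
  exists y, [set m0 | A m0 /\ lbound A m0] y).
by apply/eqP; rewrite eq_le lx //= lm.
Qed.

Lemma minimum_image (T : finType) (P : set T) (f : T -> R) t0 : P t0 ->
  (exists2 t, P t & minimum [set f t | t in P] = f t) /\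
  (forall t, P t -> minimum [set f t | t in P] <= f t).
Proof.
move=> Pt0; have Q0 : `[< P t0 >] by apply/asboolP.
case: (@arg_minP _ _ T t0 (fun t => `[< P t >]) f Q0) => t /asboolP Pt tmin.
have -> : minimum [set f t | t in P] = f t.
  apply: minimum_eq; first by exists t.
  by move=> _ [s Ps <-]; apply/tmin/asboolP.
split; first by exists t.
by move=> s Ps; apply/tmin/asboolP.
Qed.

End Minimum.

Section Rayleigh.
Context {R : realType}.

Definition qform n (A : 'M[R]_n) (v w : 'rV[R]_n) : R := (v *m A *m w^T) 0 0.

Lemma qformE n (A : 'M[R]_n) v w :
  qform A v w = \sum_i \sum_j v 0 i * A i j * w 0 j.
Proof.
rewrite /qform mxE exchange_big; apply: eq_bigr => j _.
by rewrite !mxE mulr_suml; apply: eq_bigr => i _.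
Qed.

Lemma qform1E n (v : 'rV[R]_n) : qform 1%:M v v = \sum_i v 0 i ^+ 2.
Proof.
rewrite /qform mulmx1 mxE; apply: eq_bigr => i _.
by rewrite mxE expr2.
Qed.

Lemma qform1_gt0 n (v : 'rV[R]_n) : v != 0 -> 0 < qform 1%:M v v.
Proof.
move=> v0; rewrite qform1E lt_def sumr_ge0 ?andbT; last first.
  by move=> *; apply: sqr_ge0.
apply: contra v0; rewrite psumr_eq0 => [/allP h|*]; last exact: sqr_ge0.
apply/eqP/rowP => i; rewrite mxE; apply/eqP.
by rewrite -sqrf_eq0; apply: (implyP (h i (mem_index_enum i))).
Qed.

Lemma qformDl n (A : 'M[R]_n) u v w :
  qform A (u + v) w = qform A u w + qform A v w.
Proof. by rewrite /qform !mulmxDl mxE. Qed.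

Lemma qformDr n (A : 'M[R]_n) u v w :
  qform A u (v + w) = qform A u v + qform A u w.
Proof. by rewrite /qform linearD mulmxDr mxE. Qed.

Lemma qformZl n (A : 'M[R]_n) a v w :
  qform A (a *: v) w = a * qform A v w.
Proof. by rewrite /qform -!scalemxAl mxE. Qed.

Lemma qformZr n (A : 'M[R]_n) a v w :
  qform A v (a *: w) = a * qform A v w.
Proof. by rewrite /qform linearZ /= -scalemxAr mxE. Qed.

Lemma qformC n (A : 'M[R]_n) v w : A^T = A -> qform A v w = qform A w v.
Proof.
move=> sA; have -> : qform A v w = (v *m A *m w^T)^T 0 0 by rewrite mxE.
by rewrite !trmx_mul trmxK sA mulmxA.
Qed.

(** Moving from an isotropic v by - s z, with z = v A, changes the form by
- 2 s |z|^2 + O(s^2), which would be negative for small s > 0 unless z = 0. *)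
Lemma psd_isotropic n (A : 'M[R]_n) v : A^T = A ->
    (forall w, 0 <= qform A w w) -> qform A v v = 0 -> v *m A = 0.
Proof.
move=> sA psd vv; apply/eqP/negP => /negP/qform1_gt0.
set z := v *m A; set N := qform 1%:M z z => N0.
have vz : qform A v z = N by rewrite /N /qform mulmx1.
have b0 := psd z; set b := qform A z z in b0.
have := psd (v + (- (N / (b + 1))) *: z).
rewrite qformDl !qformDr !qformZl !qformZr vv vz (qformC z v sA) vz -/b.
(* With this s the inequality reads s (s b - 2 N) >= 0, while N = s (b + 1)
   gives s b - 2 N = - s (b + 2) < 0. *)
set s := N / (b + 1) => h.
have b1 : 0 < b + 1 by lra.
have s0 : 0 < s by rewrite divr_gt0.
have sb : s * (b + 1) = N by rewrite divfK // gt_eqF.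
have : s * (s * b - N *+ 2) >= 0 by move: h; lra.
rewrite (pmulr_rge0 _ s0) -sb; nra.
Qed.

Lemma qform_continuous n (A : 'M[R]_n) : continuous (fun v => qform A v v).
Proof.
under eq_fun do rewrite qformE.
apply: continuous_big => [|i _]; first exact: add_continuous.
apply: continuous_big => [|j _]; first exact: add_continuous.
have cc k : continuous (fun v : 'rV[R]_n => v 0 k) by exact: coord_continuous.
move=> v; apply: (cvgM _ (cc j v)).
by apply: (cvgM (cc i v)); exact: cvg_cst.
Qed.

(** The topology on row vectors comes from the sup norm, so the Euclidean sphere
is a closed subset of the compact cube of vectors with entries
in [-1, 1]. *)
Lemma unit_sphere_compact n : compact [set v : 'rV[R]_n | qform 1%:M v v = 1].
Proof.
have cube : compact [set v : 'rV[R]_n | forall i, v ord0 i \in `[-1, 1]].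
  apply: (@rV_compact R n (fun=> `[-1, 1]%classic)) => i.
  exact: segment_compact.
apply: subclosed_compact cube _.
- apply: (@closed_comp _ _ (fun v : 'rV[R]_n => qform 1%:M v v)
      [set x | x = 1]).
    by move=> v _; apply: qform_continuous.
  exact: closed_eq.
- move=> v /=; rewrite qform1E => v1 i.
  rewrite in_itv /= -ler_norml -(@ler_pXn2r _ 2) ?nnegrE // expr1n -v1.
  rewrite real_normK ?num_real // (bigD1 i) //= lerDl.
  by apply: sumr_ge0 => *; apply: sqr_ge0.
Qed.

(** A minimiser v of the form on the unit sphere, with value m, is isotropic for
A - m, which is positive semidefinite by homogeneity. *)
Lemma rayleigh_min n (A : 'M[R]_n) : (0 < n)%N -> A^T = A ->
  exists v m, [/\ qform 1%:M v v = 1, v *m A = m *: v &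
    forall w, m * qform 1%:M w w <= qform A w w].
Proof.
move=> n0 sA; pose K := [set v : 'rV[R]_n | qform 1%:M v v = 1].
have K0 : K !=set0.
  exists (delta_mx 0 (Ordinal n0)).
  rewrite /K /= qform1E (bigD1 (Ordinal n0)) //=.
  rewrite !mxE !eqxx expr1n big1 ?addr0 // => i /negbTE iN.
  by rewrite mxE iN andbF expr0n.
have [v vK vmin] := compact_EVT_min K0 (@unit_sphere_compact n)
  (continuous_subspaceT (@qform_continuous n A)).
have v1 : qform 1%:M v v = 1 by move: vK; rewrite inE.
set m := qform A v v in vmin.
have mP w : m * qform 1%:M w w <= qform A w w.
  have [->|w0] := eqVneq w 0; first by rewrite /qform !mul0mx mxE mulr0.
  have ww := qform1_gt0 w0; set t := qform 1%:M w w in ww *.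
  have t0 : Num.sqrt t != 0 by rewrite gt_eqF // sqrtr_gt0.
  have tt : (Num.sqrt t)^-1 * (Num.sqrt t)^-1 = t^-1.
    by rewrite -invfM -expr2 sqr_sqrtr // ltW.
  have := vmin ((Num.sqrt t)^-1 *: w).
  rewrite inE /K /= !qformZl !qformZr !mulrA tt mulVf ?gt_eqF // => /(_ erefl).
  by rewrite mulrC ler_pdivlMr.
exists v, m; split => //.
have scalE w1 w2 :
    qform (A - m%:M) w1 w2 = qform A w1 w2 - m * qform 1%:M w1 w2.
  by rewrite /qform mulmxBr mulmxBl mul_mx_scalar mulmx1 -scalemxAl !mxE.
have : v *m (A - m%:M) = 0.
  apply: psd_isotropic.
  - by rewrite linearB /= sA tr_scalar_mx.
  - by move=> w; rewrite scalE subr_ge0.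
  - by rewrite scalE v1 mulr1 subrr.
by rewrite mulmxBr mul_mx_scalar => /subr0_eq.
Qed.

Lemma lambda_minP n (A : 'M[R]_n) : (0 < n)%N -> A^T = A ->
  (exists2 v, qform 1%:M v v = 1 & qform A v v = lambda_min A) /\
  (forall w, lambda_min A * qform 1%:M w w <= qform A w w).
Proof.
move=> n0 sA; have [v [m [v1 vm low]]] := rayleigh_min n0 sA.
have eigE a w : w *m A = a *: w -> qform A w w = a * qform 1%:M w w.
  by move=> wA; rewrite /qform wA -scalemxAl mxE mulmx1.
have -> : lambda_min A = m.
  apply: minimum_eq => /=.
    apply/eigenvalueP; exists v => //; apply/eqP => v0.
    by move: v1; rewrite v0 /qform !mul0mx mxE => /esym/eqP; rewrite oner_eq0.
  move=> a /eigenvalueP[w wA w0].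
  by rewrite -(ler_pM2r (qform1_gt0 w0)) -(eigE _ _ wA).
by split=> //; exists v => //; rewrite (eigE _ _ vm) v1 mulr1.
Qed.

End Rayleigh.

(** * Sparse eigenvalues *)

Section SparseEigenvalue.
Context {R : realType}.

(** Right multiplication by the selected rows of the identity places the entries
of v at the positions given by f and fills with zeros. *)
Lemma qform_mxsub m n (f : 'I_m -> 'I_n) (A : 'M[R]_n) v w :
  qform (mxsub f f A) v w = qform A (v *m rowsub f 1%:M) (w *m rowsub f 1%:M).
Proof.
have {1}-> : A = 1%:M *m (A *m 1%:M) by rewrite mulmx1 mul1mx.
rewrite mxsub_mul (mxsub_mul _ _ A) /qform trmx_mul trmx_mxsub trmx1 !mulmxA.
by rewrite (_ : mxsub id id A = A) //; apply/matrixP => i j; rewrite mxE.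
Qed.

Lemma mxsub1 m n (f : 'I_m -> 'I_n) : injective f ->
  mxsub f f (1%:M : 'M[R]_n) = 1%:M.
Proof. by move=> fI; apply/matrixP => i j; rewrite !mxE (inj_eq fI). Qed.

(** A unit vector that attains the smallest eigenvalue of the submatrix stays a
unit vector, with the same value of the form, when it is padded with zeros. *)
Lemma lambda_min_mxsub m n (f : 'I_m -> 'I_n) (A : 'M[R]_n) :
    (0 < m)%N -> injective f -> A^T = A ->
  lambda_min A <= lambda_min (mxsub f f A).
Proof.
move=> m0 fI sA.
have n0 : (0 < n)%N by case: (f (Ordinal m0)) => i; apply: leq_ltn_trans.
have sAf : (mxsub f f A)^T = mxsub f f A by rewrite trmx_mxsub sA.
have [[v v1 <-] _] := lambda_minP m0 sAf.
have [_ /(_ (v *m rowsub f 1%:M))] := lambda_minP n0 sA.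
by rewrite -!qform_mxsub mxsub1 // v1 mulr1.
Qed.

Context (n : nat) (A : 'M[R]_n) (sA : A^T = A).

Lemma lambda_min_principal (S : {set 'I_n}) (c : 'I_n -> R) :
    S != finset.set0 ->
  lambda_min (principal_submx A S) * \sum_(i in S) c i ^+ 2 <=
    \sum_(i in S) \sum_(j in S) c i * A i j * c j.
Proof.
rewrite -card_gt0 => S0.
have sAS : (principal_submx A S)^T = principal_submx A S.
  by rewrite /principal_submx trmx_mxsub sA.
have [_ /(_ (\row_a c (enum_val a)))] := lambda_minP S0 sAS.
have sumE (F : 'I_n -> R) : \sum_(i in S) F i = \sum_(a < #|S|) F (enum_val a).
  exact: big_enum_val.
rewrite qform1E qformE !sumE /=.
under [X in _ * X]eq_bigr do rewrite mxE.
move=> /le_trans; apply; rewrite le_eqVlt; apply/orP; left; apply/eqP.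
by apply: eq_bigr => a _; rewrite sumE; apply: eq_bigr => a' _; rewrite !mxE.
Qed.

Lemma lambda_min_sparseP k : (0 < n)%N -> (0 < k)%N ->
  (exists2 S : {set 'I_n}, S != finset.set0 &
     lambda_min_sparse A k = lambda_min (principal_submx A S)) /\
  (forall S : {set 'I_n}, S != finset.set0 -> (#|S| <= k)%N ->
     lambda_min_sparse A k <= lambda_min (principal_submx A S)).
Proof.
move=> n0 k0; pose i0 := Ordinal n0.
have P0 : [set S : {set 'I_n} | S != finset.set0 /\ (#|S| <= k)%N] [set i0]%SET.
  by rewrite /= cards1; split=> //; apply/set0Pn; exists i0; rewrite inE.
have [[S [S0 _] SE] low] :=
  minimum_image (fun S => lambda_min (principal_submx A S)) P0.
by split=> [|T T0 Tk]; [exists S|apply: low].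
Qed.

Lemma lambda_min_le_sparse k : (0 < n)%N -> (0 < k)%N ->
  lambda_min A <= lambda_min_sparse A k.
Proof.
move=> n0 k0; have [[S S0 ->] _] := lambda_min_sparseP n0 k0.
by apply: lambda_min_mxsub => //; [rewrite card_gt0|exact: enum_val_inj].
Qed.

(** The empty set is not among those over which the sparse eigenvalue is a
minimum, but for it both sides vanish. *)
Lemma lambda_min_sparse_low k (S : {set 'I_n}) (c : 'I_n -> R) :
    (0 < n)%N -> (0 < k)%N -> (#|S| <= k)%N ->
  lambda_min_sparse A k * \sum_(i in S) c i ^+ 2 <=
    \sum_(i in S) \sum_(j in S) c i * A i j * c j.
Proof.
move=> n0 k0 Sk; have [->|S0] := eqVneq S finset.set0.
  by rewrite !big_set0 mulr0.
apply: le_trans (lambda_min_principal c S0).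
apply: ler_wpM2r; first by apply: sumr_ge0 => i _; apply: sqr_ge0.
by have [_ ->] := lambda_min_sparseP n0 k0.
Qed.

End SparseEigenvalue.

(** * Normalised kernels and the theorem *)

Section Correlation.
Context {R : realType} {X : Type} (V : rkhs R X) {n : nat} (x : 'I_n -> X).
Context (k_gt0 : forall i : 'I_n, 0 < rkhs_kernel V (x i) (x i)).

Definition unit_kernel i : V :=
  (Num.sqrt (rkhs_kernel V (x i) (x i)))^-1 *: kernel_at V (x i).

Lemma rkhs_kernelE y z :
  rkhs_kernel V y z = rkhs_dot V (kernel_at V y) (kernel_at V z).
Proof. exact: kernel_reproducing. Qed.

Lemma correlation_mxE i j :
  correlation_mx V x i j = rkhs_dot V (unit_kernel i) (unit_kernel j).
Proof.
rewrite /unit_kernel dotZl dotZr -rkhs_kernelE mxE.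
rewrite sqrtrM ?invfM; last exact: ltW.
ring.
Qed.

Lemma correlation_mx_sym : (correlation_mx V x)^T = correlation_mx V x.
Proof. by apply/matrixP => i j; rewrite mxE !correlation_mxE dotC. Qed.

Lemma unit_kernel_norm i : rkhs_dot V (unit_kernel i) (unit_kernel i) = 1.
Proof.
rewrite -correlation_mxE mxE -expr2 sqrtr_sqr ger0_norm ?ltW //.
by rewrite divff ?gt_eqF.
Qed.

Lemma span_on_unit_kernel S :
  span_on unit_kernel S = span_on (fun i => kernel_at V (x i)) S.
Proof.
by apply: span_on_scale => i; rewrite invr_eq0 gt_eqF // sqrtr_gt0.
Qed.

Lemma dot_unit_kernel_sum (S : {set 'I_n}) (c : 'I_n -> R) :
  let s := \sum_(i in S) c i *: unit_kernel i in
  rkhs_dot V s s =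
    \sum_(i in S) \sum_(j in S) c i * correlation_mx V x i j * c j.
Proof.
rewrite /= dot_suml; apply: eq_bigr => i _; rewrite dotC dot_suml.
apply: eq_bigr => j _; rewrite dotZl dotZr correlation_mxE dotC; ring.
Qed.

Context {d : nat} (b : 'I_d -> V).

Lemma design_etaE S :
  design_eta x b S = \sum_(j < d) energy unit_kernel S (b j).
Proof.
apply: eq_bigr => j _; rewrite mxE /design_proj -span_on_unit_kernel /energy.
by rewrite dotC -[LHS](dot_orth_projl _ (orth_proj_span _ _ _)).
Qed.

Lemma design_eta_le (S T : {set 'I_n}) :
  S \subset T -> design_eta x b S <= design_eta x b T.
Proof.
by move=> ST; rewrite !design_etaE; apply: ler_sum => j _; apply: energy_le.
Qed.

Lemma design_eta_submodular k (L S : {set 'I_n}) :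
    (0 < n)%N -> (0 < k)%N -> (#|L :|: S| <= k)%N ->
    (L :&: S)%SET = finset.set0 ->
  lambda_min_sparse (correlation_mx V x) k *
      (design_eta x b (L :|: S)%SET - design_eta x b L) <=
    \sum_(s in S) (design_eta x b (s |: L)%SET - design_eta x b L).
Proof.
move=> n0 k0 LSk LS; rewrite !design_etaE -sumrB mulr_sumr.
under [leRHS]eq_bigr do rewrite design_etaE -sumrB.
rewrite exchange_big; apply: ler_sum => j _.
apply: energy_submodular => // [i|c /=]; first exact: unit_kernel_norm.
rewrite dot_unit_kernel_sum; apply: lambda_min_sparse_low => //.
exact: correlation_mx_sym.
Qed.

(** Needed for the convention 0 / 0 = 1: a one-element principal submatrix is
the matrix 1. *)
Lemma lambda_min_sparse_le1 k : (0 < n)%N -> (0 < k)%N ->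
  lambda_min_sparse (correlation_mx V x) k <= 1.
Proof.
move=> n0 k0; pose i := Ordinal n0.
have := @lambda_min_sparse_low _ _ _ correlation_mx_sym k [set i]%SET (fun=> 1)
  n0 k0 _.
rewrite cards1 => /(_ k0).
by rewrite !big_set1 correlation_mxE unit_kernel_norm expr1n !mulr1.
Qed.

End Correlation.

Theorem proposition27 (R : realType) (X : Type) (V : rkhs R X) (n d : nat)
    (x : 'I_n -> X) (Vd : set V) (b : 'I_d -> V)
    (hn : (0 < n)%N)
    (hk : forall i : 'I_n, 0 < rkhs_kernel V (x i) (x i))
    (hb : orthonormal_basis Vd b) :
  [/\ (forall S : {set 'I_n},
         design_eta x b S = \sum_(j < d) `|design_proj x S (b j)| ^+ 2),
      monotone_setfun (design_eta x b) &
      forall (U : {set 'I_n}) (k : nat), (1 <= k)%N ->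
        lambda_min_sparse (correlation_mx V x) (#|U| + k)
          <= submodularity_ratio (design_eta x b) U k /\
        lambda_min (correlation_mx V x)
          <= lambda_min_sparse (correlation_mx V x) (#|U| + k)].
Proof.
split.
- move=> S; rewrite design_etaE //; apply: eq_bigr => j _.
  rewrite rkhs_normE sqr_sqrtr ?dot_ge0 // /energy.
  by rewrite /design_proj -span_on_unit_kernel.
- split; last by move=> S T; apply: design_eta_le.
  move=> S; rewrite design_etaE //; apply: sumr_ge0 => j _; exact: dot_ge0.
move=> U k k1; have Uk : (0 < #|U| + k)%N by rewrite addn_gt0 k1 orbT.
split; last by apply: lambda_min_le_sparse => //; apply: correlation_mx_sym.
have P0 : [set p : {set 'I_n} * {set 'I_n} | [/\ p.1 \subset U, (#|p.2| <= k)%N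
    & (p.1 :&: p.2)%SET = finset.set0]] (finset.set0, finset.set0).
  by rewrite /= finset.sub0set cards0 finset.setI0.
rewrite /submodularity_ratio.
have [[[L S] /= [LU Sk LS] ->] _] := minimum_image
  (fun p : {set 'I_n} * {set 'I_n} =>
  ratio01 (\sum_(s in p.2) (design_eta x b (s |: p.1)%SET - design_eta x b p.1))
          (design_eta x b (p.1 :|: p.2)%SET - design_eta x b p.1)) P0.
have LSk : (#|L :|: S| <= #|U| + k)%N.
  by rewrite (leq_trans (leq_card_setU _ _)) // leq_add // subset_leq_card.
have sub := @design_eta_submodular _ _ V _ x hk _ b _ L S hn Uk LSk LS.
set N := \sum_(s in S) _ in sub *; set D := _ - _ in sub *.
have D0 : 0 <= D by rewrite subr_ge0 design_eta_le // finset.subsetUl.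
rewrite /= /ratio01; move: D0; rewrite le_eqVlt => /predU1P[D0|D0]; last first.
  by rewrite (gt_eqF D0) andbF ler_pdivlMr.
(* If adding all of S gains nothing, monotonicity forces every single gain to
   vanish, so the ratio is 0 / 0. *)
have -> : N = 0.
  apply: big1 => s sS; apply/eqP; rewrite eq_le subr_ge0 design_eta_le //.
    rewrite andbT [leRHS]D0 lerD2r design_eta_le //.
    by rewrite finset.setUC finset.setUS // finset.sub1set.
  exact: finset.subsetUr.
by rewrite -D0 eqxx; apply: lambda_min_sparse_le1.
Qed.
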